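(* Let $(P,\omega,\mathcal J,\mathfrak s)$ be an almost Kähler manifold on which an Abelian Lie group $G$ acts freely and properly by automorphisms of the almost Kähler structure, with equivariant momentum map $J:P\to U=J(P)\subset\mathfrak g^*$. Let $H$ be a $G$-invariant Hamiltonian on $P$ and $h:P/G\to\mathbb R$ the reduced Hamiltonian ($H=h\circ\pi$). Let $D$ be the connection on the symplectic stratification of $P/G$ determined by the abstract mechanical connection. Then for every $y\in P/G$, with $\mu=j(y)$, every $x\in\pi^{-1}(y)$ and every $\nu\in\mathfrak g^*$, the $\nu$-component of the infinitesimal dynamic phase $\xi_{\operatorname{dyn}}$ is $$\langle\nu,\xi_{\operatorname{dyn}}(y)\rangle=\langle\nu,D_\mu h(y)\rangle=dh\Big(T_x\pi\big(\mathcal J(x)\,(\mathbb I^{-1}(x)\cdot\nu)_P(x)\big)\Big).$$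
   Context: Almost Kähler: $\omega$ is a symplectic form, $\mathcal J$ an almost complex structure ($\mathcal J^2=-1$), $\mathfrak s$ a $\mathcal J$-invariant Riemannian metric, with $\omega(v,w)=\mathfrak s(\mathcal Jv,w)$. $G$ preserves $\omega,\mathcal J,\mathfrak s$. $\xi_P$ is the infinitesimal generator of $\xi\in\mathfrak g$, and $\omega(\xi_P,\cdot)=d\langle J,\xi\rangle$. $\pi:P\to P/G$ is the projection; $\pi$ and $J$ are surjective submersions. $X_H$ is defined by $\omega(X_H,\cdot)=dH$. Since $G$ is Abelian, $J$ is $G$-invariant and factors as $J=j\circ\pi$ with a submersion $j:P/G\to U$; the fibers $P_\mu=j^{-1}(\mu)$ are assumed connected, and are the symplectic leaves of $P/G$. $E=\operatorname{Ker}Tj$ is the characteristic distribution. $\operatorname{forg}:TU\to\mathfrak g^*$ forgets the base point. $W^\omega$ is the $\omega$-orthogonal complement. Abstract locked inertia tensor: $\mathbb I(x):\mathfrak g\to\mathfrak g^*$, $\langle\mathbb I(x)\xi,\eta\rangle=\mathfrak s(\xi_P(x),\eta_P(x))$ (an isomorphism). For Abelian $G$ both $\mathbb I$ and $\mathcal J$ can be evaluated at any $x\in\pi^{-1}(y)$. Abstract mechanical connection: the principal connection on $P\to P/G$ with $\operatorname{hor}(x)=\{v\in T_xP:\mathfrak s(v,\xi_P(x))=0\ \forall\xi\in\mathfrak g\}$; its one-form $\mathcal A$ satisfies $\operatorname{Ker}\mathcal A=\operatorname{hor}$, $\mathcal A(\xi_P)=\xi$. The corresponding reconstruction connection is $A(x)=\operatorname{hor}(x)\cap\operatorname{Ker}T_xJ$,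 the induced connection $\alpha_\mu$ on $J^{-1}(\mu)\to P_\mu$ has horizontal spaces $A(x)$, and $D(y)=T_x\pi(A(x)^\omega)$, $x\in\pi^{-1}(y)$; $D$ satisfies $T(P/G)=E\oplus D$. The map $L(D,y):\mathfrak g^*\to D(y)$ is the inverse of the isomorphism $D(y)\to\mathfrak g^*$, $v\mapsto\operatorname{forg}(T_xJ\cdot w)$, where $x\in\pi^{-1}(y)$ and $w\in T_xP$ is any vector with $T_x\pi\cdot w=v$. The $(D,\mu)$-exterior covariant derivative $D_\mu f(y)\in\mathfrak g$ of a function $f$ at $y\in P_\mu$ is defined by $\langle\nu,D_\mu f(y)\rangle=df(L(D,y)(\nu))$ for all $\nu\in\mathfrak g^*$. Infinitesimal dynamic phase: $\xi_{\operatorname{dyn}}(y)=\alpha_\mu(X_H(x))\in\mathfrak g$, $x\in\pi^{-1}(y)$, $\mu=j(y)$, the coefficient of the reconstruction equation $\dot g_t=g_t\,\alpha_\mu(X_H(d_t))$, $g_0=\operatorname{Id}$ ($d_t$ the horizontal lift of the reduced solution $y_t$), so that the dynamic phase is $g_{\operatorname{dyn}}=\exp\int_0^T\xi_{\operatorname{dyn}}(y_t)\,dt$. *)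

(* Defs.v *)
From HB Require Import structures.
From mathcomp Require Import all_boot all_order all_algebra.
From mathcomp Require Import all_classical all_reals all_analysis.

Set Implicit Arguments.
Unset Strict Implicit.
Unset Printing Implicit Defensive.

Import Order.TTheory GRing.Theory Num.Theory.
Import numFieldNormedType.Exports.
Local Open Scope classical_set_scope.
Local Open Scope ring_scope.

(* [U] is meant to be open and [V], [W] finite-dimensional, so that letting the
   direction [v] be arbitrary but fixed gives the usual C^k classes. *)
Fixpoint Ck {R : realType} {V W : normedModType R} (k : nat) (U : set V)
    (f : V -> W) : Prop :=
  if k is k'.+1 then
    (forall x, U x -> differentiable f x) /\
    (forall v, Ck k' U (fun x => 'd f x v))
  else forall x, U x -> {for x, continuous f}.

Definition smooth_on {R : realType} {V W : normedModType R} (U : set V)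
    (f : V -> W) : Prop :=
  forall k, Ck k U f.

(* The values of [cmap] outside [dom] and of [cinv] outside [cod] are junk. *)
Record chart (R : realType) (n : nat) (M : topologicalType) := Chart {
  dom : set M;
  cod : set 'rV[R]_n;
  cmap : M -> 'rV[R]_n;
  cinv : 'rV[R]_n -> M;
  dom_open : open dom;
  cod_open : open cod;
  cmap_cod : forall x, dom x -> cod (cmap x);
  cinv_dom : forall a, cod a -> dom (cinv a);
  cmapK : forall x, dom x -> cinv (cmap x) = x;
  cinvK : forall a, cod a -> cmap (cinv a) = a;
  cmap_continuous : forall x, dom x -> {for x, continuous cmap};
  cinv_continuous : forall a, cod a -> {for a, continuous cinv}
}.

(* [chart_at x] is a preferred chart around [x]; it only serves to represent
   tangent vectors at [x] by coordinates, see [tangent]. *)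
Record manifold (R : realType) (n : nat) := Manifold {
  carrier :> topologicalType;
  manifold_hausdorff : hausdorff_space carrier;
  manifold_second_countable : @second_countable carrier;
  atlas : set (chart R n carrier);
  chart_at : carrier -> chart R n carrier;
  chart_at_atlas : forall x, atlas (chart_at x);
  chart_at_dom : forall x, dom (chart_at x) x;
  atlas_compatible : forall c d, atlas c -> atlas d ->
    smooth_on [set a | cod c a /\ dom d (cinv c a)] (cmap d \o cinv c)
}.

(* The tangent space T_xM: the vector with coordinates [v] in the coordinate
   basis of [chart_at x] at [x] is represented by [v]. *)
Definition tangent {R : realType} {n : nat} {M : manifold R n} (x : M) :
  normedModType R := 'rV[R]_n.

Section SmoothMaps.
Context {R : realType} {m n p : nat}.
Context {M : manifold R m} {N : manifold R n} {Q : manifold R p}.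

Definition smooth_map (F : M -> N) : Prop :=
  continuous F /\
  forall c d, atlas c -> atlas d ->
    smooth_on [set a | cod c a /\ dom d (F (cinv c a))]
              (cmap d \o F \o cinv c).

(* Smoothness of M x N -> Q, read in the product charts of M x N. *)
Definition smooth_map2 (F : M -> N -> Q) : Prop :=
  continuous (fun z : M * N => F z.1 z.2) /\
  forall (c : chart R m M) (d : chart R n N) (e : chart R p Q),
    atlas c -> atlas d -> atlas e ->
    smooth_on [set a : 'rV[R]_m * 'rV[R]_n |
                 [/\ cod c a.1, cod d a.2 & dom e (F (cinv c a.1) (cinv d a.2))]]
              (fun a => cmap e (F (cinv c a.1) (cinv d a.2))).

Definition smooth_fun {W : normedModType R} (f : M -> W) : Prop :=
  forall c, atlas c -> smooth_on (cod c) (f \o cinv c).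

Definition tmap (F : M -> N) (x : M) : {linear tangent x -> tangent (F x)} :=
  'd (cmap (chart_at (F x)) \o F \o cinv (chart_at x)) (cmap (chart_at x) x).

(* Derivative of a function with values in a normed space [W]. This is df(x)
   when W = R, and the tangent map followed by the map TW -> W forgetting the
   base point in general. *)
Definition dfun {W : normedModType R} (f : M -> W) (x : M) :
    {linear tangent x -> W} :=
  'd (f \o cinv (chart_at x)) (cmap (chart_at x) x).

Definition coords (c : chart R m M) (x : M) : {linear tangent x -> 'rV[R]_m} :=
  dfun (cmap c) x.

(* The i-th coordinate vector field of the chart [c], at [x]. *)
Definition frame (c : chart R m M) (i : 'I_m) (x : M) : tangent x :=
  'd (cmap (chart_at x) \o cinv c) (cmap c x) (delta_mx 0 i).

End SmoothMaps.

Section Tensors.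
Context {R : realType} {n : nat} {P : manifold R n}.

Definition bilinear_field := forall x : P, {biscalar (tangent x)}.
Definition endo_field := forall x : P, {linear tangent x -> tangent x}.

Definition component (b : bilinear_field) (c : chart R n P) (i j : 'I_n)
    (a : 'rV[R]_n) : R :=
  b (cinv c a) (frame c i (cinv c a)) (frame c j (cinv c a)).

Definition smooth_bilinear (b : bilinear_field) : Prop :=
  forall c, atlas c -> forall i j, smooth_on (cod c) (component b c i j).

Definition smooth_endo (e : endo_field) : Prop :=
  forall c, atlas c -> forall i,
    smooth_on (cod c)
      (fun a => coords c (cinv c a) (e (cinv c a) (frame c i (cinv c a)))).

(* d b = 0, in coordinates, for an alternating b *)
Definition closed_form (b : bilinear_field) : Prop :=
  forall c, atlas c -> forall (i j k : 'I_n) a, cod c a ->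
    'd (component b c j k) a (delta_mx 0 i) +
    'd (component b c k i) a (delta_mx 0 j) +
    'd (component b c i j) a (delta_mx 0 k) = 0.

Definition symplectic_form (w : bilinear_field) : Prop :=
  [/\ smooth_bilinear w,
      forall x (v : tangent x), w x v v = 0,
      forall x (v : tangent x), (forall u, w x v u = 0) -> v = 0 &
      closed_form w].

Definition riemannian_metric (s : bilinear_field) : Prop :=
  [/\ smooth_bilinear s,
      forall x (u v : tangent x), s x u v = s x v u &
      forall x (v : tangent x), v != 0 -> 0 < s x v v].

Definition almost_complex (I : endo_field) : Prop :=
  smooth_endo I /\ forall x (v : tangent x), I x (I x v) = - v.

Definition omega_perp (w : bilinear_field) (x : P) (S : set (tangent x)) :
    set (tangent x) :=
  [set v | forall u, S u -> w x v u = 0].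

Definition hamiltonian_vector_field (w : bilinear_field) (H : P -> R)
    (X : forall x : P, tangent x) : Prop :=
  forall x (v : tangent x), w x (X x) v = dfun H x v.

End Tensors.

Arguments bilinear_field {R n} P.
Arguments endo_field {R n} P.

Record almost_kahler (R : realType) (n : nat) (P : manifold R n) := AlmostKahler {
  omega : bilinear_field P;
  cplx : endo_field P;
  metric : bilinear_field P;
  omega_symplectic : symplectic_form omega;
  cplx_almost_complex : almost_complex cplx;
  metric_riemannian : riemannian_metric metric;
  metric_invariant : forall x (v w : tangent x),
    metric x (cplx x v) (cplx x w) = metric x v w;
  omega_metric : forall x (v w : tangent x),
    omega x v w = metric x (cplx x v) w
}.

Record lie_group (R : realType) (d : nat) := LieGroup {
  lie_manifold :> manifold R d;
  lmul : lie_manifold -> lie_manifold -> lie_manifold;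
  lone : lie_manifold;
  linv : lie_manifold -> lie_manifold;
  lmulA : associative lmul;
  lmul1 : left_id lone lmul;
  lmulV : left_inverse lone linv lmul;
  lmul_smooth : smooth_map2 lmul;
  linv_smooth : smooth_map linv
}.

Definition abelian_group (R : realType) (d : nat) (G : lie_group R d) : Prop :=
  commutative (@lmul R d G).

Definition lie_algebra {R : realType} {d : nat} (G : lie_group R d) :
  normedModType R := tangent (lone G).

(* As the elements of the Lie algebra are rows, those of its dual are columns. *)
Definition dual_algebra {R : realType} {d : nat} (G : lie_group R d) :
  normedModType R := 'cV[R]_d.

Definition pairing {R : realType} {d : nat} {G : lie_group R d}
    (nu : dual_algebra G) (xi : lie_algebra G) : R :=
  ((xi : 'rV[R]_d) *m (nu : 'cV[R]_d)) 0 0.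

Definition Ad {R : realType} {d : nat} {G : lie_group R d} (g : G) :
    lie_algebra G -> lie_algebra G :=
  tmap (fun k => lmul (lmul g k) (linv g)) (lone G).

Record action (R : realType) (d n : nat) (G : lie_group R d) (P : manifold R n) :=
  Action {
  act :> G -> P -> P;
  act1 : forall x, act (lone G) x = x;
  actM : forall g k x, act (lmul g k) x = act g (act k x);
  act_smooth : smooth_map2 act
}.

Section Actions.
Context {R : realType} {d n : nat} {G : lie_group R d} {P : manifold R n}.
Variable Phi : action G P.

Definition free_action : Prop := forall g x, Phi g x = x -> g = lone G.

Definition proper_action : Prop :=
  forall K : set (P * P), compact K ->
    compact [set z : G * P | K (Phi z.1 z.2, z.2)].

(* The infinitesimal generator xi_P(x), i.e. the derivative at the identity of
   g |-> g x in the direction xi. The target type uses that [tangent] does not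
   depend on the point: the representing chart is that of [Phi (lone G) x = x]. *)
Definition generator (x : P) : {linear lie_algebra G -> tangent x} :=
  tmap (Phi^~ x) (lone G).

Definition acts_by_automorphisms (K : almost_kahler P) : Prop :=
  forall (g : G) (x : P),
    [/\ forall v w : tangent x,
          omega K (Phi g x) (tmap (Phi g) x v) (tmap (Phi g) x w) = omega K x v w,
        forall v : tangent x,
          cplx K (Phi g x) (tmap (Phi g) x v) = tmap (Phi g) x (cplx K x v) &
        forall v w : tangent x,
          metric K (Phi g x) (tmap (Phi g) x v) (tmap (Phi g) x w) = metric K x v w].

Definition momentum_map (w : bilinear_field P) (J : P -> dual_algebra G) : Prop :=
  smooth_fun J /\
  forall x xi (v : tangent x),
    w x (generator x xi) v = dfun (fun z => pairing (J z) xi) x v.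

(* J (g x) = Ad^*_{g^-1} (J x) *)
Definition equivariant (J : P -> dual_algebra G) : Prop :=
  forall g x xi, pairing (J (Phi g x)) xi = pairing (J x) (Ad (linv g) xi).

(* Up to diffeomorphism, P/G is the unique manifold with such a projection. *)
Definition orbit_projection {q : nat} {Q : manifold R q} (pi : P -> Q) : Prop :=
  [/\ smooth_map pi,
      forall y, exists x, pi x = y,
      forall x (v : tangent (pi x)), exists w, tmap pi x w = v &
      forall x x', pi x = pi x' <-> exists g, x' = Phi g x].

End Actions.

(* Submersion onto the image, which is then an open subset U of [W]. *)
Definition linear_submersion {R : realType} {n : nat} {M : manifold R n}
    {W : normedModType R} (f : M -> W) : Prop :=
  smooth_fun f /\ forall x (u : W), exists v : tangent x, dfun f x v = u.

Section Mechanics.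
Context {R : realType} {d n q : nat} {G : lie_group R d}.
Context {P : manifold R n} {Q : manifold R q}.
Variables (K : almost_kahler P) (Phi : action G P).
Variables (pi : P -> Q) (J : P -> dual_algebra G).

Definition inertia (x : P) (xi : lie_algebra G) : dual_algebra G :=
  \col_i metric K x (generator Phi x xi) (generator Phi x (delta_mx 0 i)).

Lemma inertiaP x xi eta :
  pairing (inertia x xi) eta =
  metric K x (generator Phi x xi) (generator Phi x eta).
Proof.
rewrite /pairing mxE [in RHS](row_sum_delta eta) !linear_sum.
apply: eq_bigr => i _; rewrite mxE !linearZ.
by [].
Qed.

(* Under the hypotheses that make these notions meaningful, [xget 0] is applied
   below to singletons only. *)
Definition inertia_inv (x : P) (nu : dual_algebra G) : lie_algebra G :=
  xget 0 [set xi | inertia x xi = nu].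

Definition mech_hor (x : P) : set (tangent x) :=
  [set v | forall xi, metric K x v (generator Phi x xi) = 0].

Definition ker_TJ (x : P) : set (tangent x) := [set v | dfun J x v = 0].

Definition rec_hor (x : P) : set (tangent x) := @mech_hor x `&` @ker_TJ x.

(* Connection forms alpha_mu on the bundles J^-1(mu) -> P_mu, for all mu at
   once: alpha_mu(x), with mu = J x, is the restriction of [alpha x] to
   T_x J^-1(mu) = Ker T_xJ; the values of [alpha x] elsewhere are irrelevant. *)
Definition induced_connection
    (alpha : forall x : P, {linear tangent x -> lie_algebra G}) : Prop :=
  forall x, (forall xi, alpha x (generator Phi x xi) = xi) /\
    (forall v : tangent x, @ker_TJ x v -> (alpha x v = 0 <-> @rec_hor x v)).

(* D(y) = T_x pi (A(x)^omega), which is the same for all x over y *)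
Definition strat_connection (y : Q) : set (tangent y) :=
  [set v | exists x, pi x = y /\
    exists2 w : tangent x, omega_perp (omega K) (@rec_hor x) w & tmap pi x w = v].

(* L(D, y), the inverse of D(y) -> g^*, v |-> forg (T_xJ w) with T_x pi w = v *)
Definition lift_map (y : Q) (nu : dual_algebra G) : tangent y :=
  xget 0 [set v | @strat_connection y v /\
    exists x, pi x = y /\ exists2 w : tangent x, tmap pi x w = v & dfun J x w = nu].

(* D_mu f (y), with mu the value at y of the quotient of J *)
Definition ext_cov_deriv (f : Q -> R) (y : Q) : lie_algebra G :=
  xget 0 [set xi | forall nu, pairing nu xi = dfun f y (lift_map y nu)].

Definition dyn_phase (alpha : forall x : P, {linear tangent x -> lie_algebra G})
    (X : forall x : P, tangent x) (y : Q) : lie_algebra G :=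
  xget 0 [set xi | exists2 x, pi x = y & xi = alpha x (X x)].

End Mechanics.

(* Main.v *)
Require Import Defs.
From HB Require Import structures.
From mathcomp Require Import all_boot all_order all_algebra.
From mathcomp Require Import all_classical all_reals all_analysis.

Set Implicit Arguments.
Unset Strict Implicit.
Unset Printing Implicit Defensive.

Import Order.TTheory GRing.Theory Num.Theory.
Import numFieldNormedType.Exports.
Local Open Scope classical_set_scope.
Local Open Scope ring_scope.

(** Fix x over y and write xi_P for the infinitesimal generator at x, I for the
    almost complex structure, s for the metric and II for the locked inertia
    tensor. Both equalities come from the single vector

      V = I (II^-1 nu)_P  in T_xP,

    whose projection to T_y(P/G) is [locked_lift].

    First, L(D, y) nu = T pi V. The compatibility of omega and s turns the
    definition of the momentum map J into TJ (I xi_P) = II xi, so V has momentum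
    derivative nu. As J is constant on orbits, it also gives TJ xi_P = 0, and the
    reconstruction space A consists of the v for which TJ v and TJ (I v) both
    vanish ([rec_horP]). Hence A is stable under I, the metric is nondegenerate
    on it, and A^omega is the sum of the vectors xi_P + I eta_P
    ([rec_hor_perp]). The generators project to 0, so D(y) is made of the
    projections of the I eta_P, and eta is determined by the momentum
    derivative. The definitions of D and L let the point over y vary; G moves
    one choice to another, and as G is Abelian and acts by automorphisms it
    preserves generators, inertia and I ([locked_lift_fiber]). This gives
    [lift_mapE], and so <nu, D_mu h(y)> = dh (T pi V).

    Second, the dynamic phase zeta = alpha(X_H) satisfies <nu, zeta> =
    dh (T pi V). Since H is invariant, X_H is tangent to the level set of J, and
    X_H minus its vertical part zeta_P lies in A, so it is metrically orthogonal
    to all generators. With eta = II^-1 nu this yields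

      <nu, zeta> = s(zeta_P, eta_P) = s(X_H, eta_P) = omega(X_H, I eta_P)
                 = dH(V) = dh (T pi V),

    which is [pairing_reconstruction].

    The underlying analysis is the chain rule: tangent maps are differentials read in preferred
    charts, and composites are differentiated by inserting an intermediate chart
    ([dfun_comp]). *)

(** * The chain rule in charts *)

(** Lets a function be replaced by its expression through an intermediate chart,
    which is valid near the point only. *)
Lemma diff_germ (R : realType) (V W : normedModType R) (f g : V -> W) (x : V) :
  differentiable f x -> (\forall z \near x, g z = f z) ->
  'd g x = 'd f x :> (V -> W).
Proof.
move=> df gf; apply: diff_unique; first exact: diff_continuous.
have gx := gf; have /eqaddoP fo := diff_locally df.
apply/eqaddoP => e e0; move: gf (fo e e0).
rewrite (near_shift 0) subr0; apply: filterS2 => h /= gfh.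
by rewrite !fctE /= gfh (nbhs_singleton gx).
Qed.

Lemma smooth_differentiable (R : realType) (V W : normedModType R) (U : set V)
    (f : V -> W) x :
  smooth_on U f -> U x -> differentiable f x.
Proof. by move=> /(_ 1%N)[] /= fU _; exact: fU. Qed.

Section Charts.
Context {R : realType} {m : nat} {M : manifold R m}.

Definition differentiable_fun (W : normedModType R) (f : M -> W) (x : M) : Prop :=
  differentiable (f \o cinv (chart_at x)) (cmap (chart_at x) x).

Lemma cod_chart_at (x : M) : cod (chart_at x) (cmap (chart_at x) x).
Proof. exact/cmap_cod/chart_at_dom. Qed.

Lemma cinv_chart_at (x : M) : cinv (chart_at x) (cmap (chart_at x) x) = x.
Proof. exact/cmapK/chart_at_dom. Qed.

Lemma smooth_fun_differentiable (W : normedModType R) (f : M -> W) (x : M) :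
  smooth_fun f -> differentiable_fun f x.
Proof.
move=> fs; apply: (smooth_differentiable (fs _ (chart_at_atlas x))).
exact: cod_chart_at.
Qed.

End Charts.

Section ChainRule.
Context {R : realType} {m n : nat} {M : manifold R m} {N : manifold R n}.

Definition differentiable_map (F : M -> N) (x : M) : Prop :=
  {for x, continuous F} /\
  differentiable (cmap (chart_at (F x)) \o F \o cinv (chart_at x))
    (cmap (chart_at x) x).

Lemma smooth_map_differentiable (F : M -> N) (x : M) :
  smooth_map F -> differentiable_map F x.
Proof.
move=> [Fc Fs]; split; first exact: Fc.
apply: (smooth_differentiable
          (Fs _ _ (chart_at_atlas x) (chart_at_atlas (F x)))) => /=.
by split; [exact: cod_chart_at | rewrite cinv_chart_at; exact: chart_at_dom].
Qed.

Lemma near_cinv_chart_at (F : M -> N) (x : M) (U : set N) :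
  {for x, continuous F} -> nbhs (F x) U ->
  \forall a \near cmap (chart_at x) x, U (F (cinv (chart_at x) a)).
Proof.
move=> Fx UF.
have Fcx : {for cmap (chart_at x) x, continuous (F \o cinv (chart_at x))}.
  apply: continuous_comp; last by rewrite cinv_chart_at.
  exact/cinv_continuous/cod_chart_at.
by apply: Fcx; rewrite /= cinv_chart_at.
Qed.

(** The intermediate chart around [F x] can be inserted between [F] and [f]
    because, by continuity, [F] maps a neighbourhood of [x] into its domain. The
    point [y] is kept apart from [F x] since actions give [Phi (lone G) x] equal,
    but not convertible, to [x]. *)
Lemma dfun_comp (W : normedModType R) (f : N -> W) (F : M -> N) (x : M) (y : N) :
  F x = y -> differentiable_map F x -> differentiable_fun f y ->
  forall v : tangent x, dfun (f \o F) x v = dfun f y (tmap F x v) :> W.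
Proof.
move=> <- [Fc Fd] fd v; rewrite /dfun /tmap.
set c := chart_at x; set e := chart_at (F x).
pose fe := f \o cinv e; pose Fce := cmap e \o F \o cinv c.
have Fx : Fce (cmap c x) = cmap e (F x) by rewrite /Fce /= cinv_chart_at.
have fFd : differentiable (fe \o Fce) (cmap c x).
  by apply: differentiable_comp => //; rewrite Fx.
rewrite (diff_germ fFd).
  by rewrite diff_comp ?Fx.
have De : nbhs (F x) (dom e).
  by apply: open_nbhs_nbhs; split; [exact: dom_open | exact: chart_at_dom].
apply: filterS (near_cinv_chart_at Fc De) => a /= ea.
by rewrite /fe /Fce /= cmapK.
Qed.

End ChainRule.

Section Maps.
Context {R : realType} {m n p : nat}.
Context {M : manifold R m} {N : manifold R n} {Q : manifold R p}.

(** [tmap F' y] is [dfun] of [F'] followed by a chart. *)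
Lemma tmap_comp (F : M -> N) (F' : N -> Q) (x : M) (y : N) :
  F x = y -> differentiable_map F x -> differentiable_map F' y ->
  forall v : tangent x, tmap (F' \o F) x v = tmap F' y (tmap F x v) :> 'rV[R]_p.
Proof.
move=> <- Fd [F'c F'd] v.
exact: (dfun_comp (f := cmap (chart_at (F' (F x))) \o F') erefl Fd).
Qed.

Lemma differentiable_map_slice1 (F : M -> N -> Q) (x : M) (y : N) :
  smooth_map2 F -> differentiable_map (F^~ y) x.
Proof.
move=> [Fc Fs]; split.
  apply: (@continuous_comp _ _ _ (fun z => (z, y)) (fun z => F z.1 z.2)).
    by apply: cvg_pair; [exact: cvg_id | exact: cvg_cst].
  exact: Fc.
set c := chart_at x; set e := chart_at y; set k := chart_at (F x y).
pose Fcek (a : 'rV[R]_m * 'rV[R]_n) := cmap k (F (cinv c a.1) (cinv e a.2)).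
rewrite (_ : _ \o _ = Fcek \o (fun a => (a, cmap e y))); last first.
  by apply/funext => a /=; rewrite /Fcek /= cinv_chart_at.
apply: differentiable_comp; first by apply: differentiable_pair.
apply: (smooth_differentiable (Fs c e k _ _ _)); try exact: chart_at_atlas.
split; [exact: cod_chart_at | exact: cod_chart_at |] => /=.
by rewrite !cinv_chart_at; exact: chart_at_dom.
Qed.

Lemma differentiable_map_slice2 (F : M -> N -> Q) (x : M) (y : N) :
  smooth_map2 F -> differentiable_map (F x) y.
Proof.
move=> [Fc Fs]; split.
  apply: (@continuous_comp _ _ _ (fun z => (x, z)) (fun z => F z.1 z.2)).
    by apply: cvg_pair; [exact: cvg_cst | exact: cvg_id].
  exact: Fc.
set c := chart_at x; set e := chart_at y; set k := chart_at (F x y).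
pose Fcek (a : 'rV[R]_m * 'rV[R]_n) := cmap k (F (cinv c a.1) (cinv e a.2)).
rewrite (_ : _ \o _ = Fcek \o (fun a => (cmap c x, a))); last first.
  by apply/funext => a /=; rewrite /Fcek /= cinv_chart_at.
apply: differentiable_comp; first by apply: differentiable_pair.
apply: (smooth_differentiable (Fs c e k _ _ _)); try exact: chart_at_atlas.
split; [exact: cod_chart_at | exact: cod_chart_at |] => /=.
by rewrite !cinv_chart_at; exact: chart_at_dom.
Qed.

End Maps.

(** * Pointwise linear algebra *)

Section DualAlgebra.
Context {R : realType} {d : nat} {G : lie_group R d}.
Implicit Types (nu : dual_algebra G) (xi : lie_algebra G).

Lemma pairing_delta nu i :
  pairing nu (delta_mx 0 i : lie_algebra G) = (nu : 'cV[R]_d) i 0.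
Proof. by rewrite /pairing -rowE mxE. Qed.

Lemma pairing_injl nu nu' :
  (forall xi, pairing nu xi = pairing nu' xi) -> nu = nu'.
Proof.
move=> nuP; apply/matrixP => i k; rewrite (ord1 k).
by rewrite -!pairing_delta nuP.
Qed.

Lemma pairing_eq0r xi : (forall nu, pairing nu xi = 0) -> xi = 0.
Proof.
move=> xiP; apply/rowP => i.
by have := xiP (delta_mx i 0); rewrite /pairing -colE !mxE.
Qed.

(** A continuous linear map commutes with differentials. *)
Lemma dfun_pairing n (P : manifold R n) (J : P -> dual_algebra G) (x : P) xi :
  differentiable_fun J x -> forall v : tangent x,
  dfun (fun z => pairing (J z) xi) x v = pairing (dfun J x v) xi.
Proof.
move=> Jd v; pose p nu := pairing nu xi.
have p_linear : linear p.
  by move=> a nu nu'; rewrite /p /pairing mulmxDr -scalemxAr !mxE.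
pose p_lin : {linear dual_algebra G -> R} :=
  HB.pack p (GRing.isLinear.Build _ _ _ _ _ p_linear).
have p_cont : continuous p_lin.
  move=> nu; apply: differentiable_continuous.
  rewrite (_ : p_lin = \sum_(i < d) xi 0 i *: (fun nu' => nu' i 0) :> (_ -> _)).
    apply: differentiable_sum => i; apply: differentiableZ.
    exact: differentiable_coord.
  by apply/funext => nu'; rewrite fct_sumE [LHS]mxE.
rewrite /dfun.
rewrite (@diff_comp _ _ _ _ (J \o cinv (chart_at x)) p_lin) //.
  by rewrite (diff_lin _ p_cont).
exact: linear_differentiable.
Qed.

End DualAlgebra.

Section AlmostKahler.
Context {R : realType} {n : nat} {P : manifold R n}.
Variables (K : almost_kahler P) (x : P).
Implicit Types v w : tangent x.

Lemma cplxK v : cplx K x (cplx K x v) = - v.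
Proof. by have [_] := cplx_almost_complex K; exact. Qed.

Lemma metricC v w : metric K x v w = metric K x w v.
Proof. by have [_ + _] := metric_riemannian K; exact. Qed.

Lemma metric_eq0 v : metric K x v v = 0 -> v = 0.
Proof.
have [_ _ pos] := metric_riemannian K.
by move=> vv0; apply/eqP/negPn/negP => /pos; rewrite vv0 ltxx.
Qed.

Lemma omega_cplxr v w : omega K x v (cplx K x w) = metric K x v w.
Proof. by rewrite omega_metric metric_invariant. Qed.

Lemma omega_cplxl v w : omega K x (cplx K x v) w = - metric K x v w.
Proof. by rewrite omega_metric cplxK linearNl. Qed.

Lemma omegaC v w : omega K x v w = - omega K x w v.
Proof.
have [_ alt _ _] := omega_symplectic K.
apply/eqP; rewrite -addr_eq0; have := alt x (v + w).
by rewrite linearDl !linearD /= !alt addr0 add0r addrC => ->.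
Qed.

End AlmostKahler.

Section InvariantFunctions.
Context {R : realType} {d n : nat} {G : lie_group R d} {P : manifold R n}.
Variables (Phi : action G P) (x : P).

(** The generator is the velocity of the orbit map, along which [f] is
    constant. *)
Lemma dfun_generator (W : normedModType R) (f : P -> W) :
  differentiable_fun f x -> (forall g, f (Phi g x) = f x) ->
  forall xi, dfun f x (generator Phi x xi) = 0.
Proof.
move=> fd finv xi.
have Phid := differentiable_map_slice1 (lone G) x (act_smooth Phi).
rewrite -(dfun_comp (F := Phi^~ x) (act1 Phi x) Phid fd) (_ : f \o _ = cst (f x)).
  by rewrite /dfun diff_cst.
exact/funext.
Qed.

Lemma tmap_generator q (Q : manifold R q) (F : P -> Q) :
  differentiable_map F x -> (forall g, F (Phi g x) = F x) ->
  forall xi, tmap F x (generator Phi x xi) = 0.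
Proof.
move=> [_ Fd] Finv xi.
apply: (dfun_generator (f := cmap (chart_at (F x)) \o F)) => // g /=.
by rewrite Finv.
Qed.

End InvariantFunctions.

(** * Momentum map, locked inertia tensor and reconstruction spaces *)

Section MomentumMap.
Context {R : realType} {d n : nat} {G : lie_group R d} {P : manifold R n}.
Variables (K : almost_kahler P) (Phi : action G P) (J : P -> dual_algebra G).
Hypothesis J_momentum : momentum_map Phi (omega K) J.
Hypothesis J_submersion : linear_submersion J.
Hypothesis J_invariant : forall g z, J (Phi g z) = J z.
Variable x : P.
Implicit Types (xi eta zeta : lie_algebra G) (nu : dual_algebra G).
Implicit Types v w u : tangent x.

Local Notation gen := (generator Phi x).
Local Notation I := (cplx K x).
Local Notation s := (metric K x).

Lemma pairing_dmomentum xi v : pairing (dfun J x v) xi = omega K x (gen xi) v.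
Proof.
have [Js ->] := J_momentum; rewrite dfun_pairing //.
exact: smooth_fun_differentiable.
Qed.

Lemma dmomentum_generator xi : dfun J x (gen xi) = 0.
Proof.
by apply: dfun_generator => //; apply/smooth_fun_differentiable/J_momentum.1.
Qed.

(** Both sides pair with [eta] to s(xi_P, eta_P), by
    omega(eta_P, I xi_P) = s(eta_P, xi_P). *)
Lemma dmomentum_cplx_generator xi :
  dfun J x (I (gen xi)) = inertia K Phi x xi.
Proof.
apply: pairing_injl => eta.
by rewrite pairing_dmomentum omega_cplxr inertiaP metricC.
Qed.

(** The momentum map is a submersion, so its differential detects [xi]. *)
Lemma generator_eq0 xi : gen xi = 0 -> xi = 0.
Proof.
move=> xi0; apply: pairing_eq0r => nu.
have [_ /(_ x nu)[v <-]] := J_submersion.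
by rewrite pairing_dmomentum xi0 linear0l.
Qed.

Lemma inertia_eq0 xi : inertia K Phi x xi = 0 -> xi = 0.
Proof.
move=> xi0; apply/generator_eq0/(@metric_eq0 _ _ _ K).
by rewrite -inertiaP xi0 /pairing mulmx0 mxE.
Qed.

Lemma inertia_linear : linear (inertia K Phi x).
Proof.
by move=> a xi eta; apply/colP => i; rewrite !mxE linearP /= linearDl linearZl.
Qed.

(** The metric is positive definite on generators, so the inertia tensor is
    injective, between spaces of the same finite dimension. *)
Lemma inertia_surjective nu : exists xi, inertia K Phi x xi = nu.
Proof.
pose f xi : 'rV[R]_d := (inertia K Phi x xi)^T.
have f_linear : linear f.
  by move=> a xi eta; rewrite /f inertia_linear linearP.
pose f_lin : {linear 'rV[R]_d -> 'rV[R]_d} :=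
  HB.pack f (GRing.isLinear.Build _ _ _ _ _ f_linear).
have f_unit : lin1_mx f_lin \in unitmx.
  rewrite -row_free_unit; apply: inj_row_free => xi.
  by rewrite mul_rV_lin1 => /(congr1 trmx); rewrite trmxK trmx0 => /inertia_eq0.
exists ((nu : 'cV_d)^T *m invmx (lin1_mx f_lin)).
apply: trmx_inj; rewrite -[LHS]/(f_lin _) -(mul_rV_lin1 f_lin).
by rewrite mulmxKV.
Qed.

Lemma inertia_invK nu : inertia K Phi x (inertia_inv K Phi x nu) = nu.
Proof. exact: (xgetPex 0 (inertia_surjective nu)). Qed.

Lemma metric_generator v xi :
  s v (gen xi) = pairing (dfun J x (I v)) xi.
Proof. by rewrite pairing_dmomentum omega_cplxr metricC. Qed.

(** In this form the reconstruction space is visibly stable under the almost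
    complex structure. *)
Lemma rec_horP v :
  rec_hor K Phi J (x:=x) v <-> dfun J x v = 0 /\ dfun J x (I v) = 0.
Proof.
split=> [[vh vJ]|[vJ vIJ]]; split=> //.
  by apply: pairing_injl => xi; rewrite -metric_generator vh /pairing mulmx0 mxE.
by move=> xi; rewrite metric_generator vIJ /pairing mulmx0 mxE.
Qed.

Lemma cplx_generator_perp xi :
  omega_perp (omega K) (rec_hor K Phi J (x:=x)) (I (gen xi)).
Proof.
by move=> u [+ _]; rewrite omega_cplxl metricC => ->; rewrite oppr0.
Qed.

Lemma generator_perp xi :
  omega_perp (omega K) (rec_hor K Phi J (x:=x)) (gen xi).
Proof.
move=> u [_ Ju]; rewrite -pairing_dmomentum Ju.
by rewrite /pairing mulmx0 mxE.
Qed.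

(** Subtracting from [w] the combination of generators with the same values of
    TJ and TJ o I leaves a vector [u] of A that is still omega-orthogonal to A.
    Since A contains I u, omega(u, I u) = s(u, u) vanishes. *)
Lemma rec_hor_perp w :
  omega_perp (omega K) (rec_hor K Phi J (x:=x)) w ->
  w = gen (inertia_inv K Phi x (dfun J x (I w))) +
      I (gen (inertia_inv K Phi x (dfun J x w))).
Proof.
move=> wA; set zeta := inertia_inv _ _ _ _; set eta := inertia_inv _ _ _ _.
apply/eqP; rewrite -subr_eq0 opprD addrA; apply/eqP; set u := w - _ - _.
have uJ : dfun J x u = 0.
  rewrite !linearB /= dmomentum_generator dmomentum_cplx_generator.
  by rewrite inertia_invK subr0 subrr.
have uIJ : dfun J x (I u) = 0.
  rewrite !linearB /= cplxK linearN /= dmomentum_generator.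
  by rewrite dmomentum_cplx_generator inertia_invK oppr0 subr0 subrr.
have Iu_rec : rec_hor K Phi J (x:=x) (I u).
  by apply/rec_horP; split=> //; rewrite cplxK linearN /= uJ oppr0.
apply: (@metric_eq0 _ _ _ K); rewrite -omega_cplxr !linearBl /=.
by rewrite wA // generator_perp // cplx_generator_perp // !subr0.
Qed.

End MomentumMap.

(** * Independence of the point of an orbit *)

Section Translation.
Context {R : realType} {d n : nat} {G : lie_group R d} {P : manifold R n}.
Variables (K : almost_kahler P) (Phi : action G P).
Hypothesis G_abelian : abelian_group G.
Hypothesis Phi_aut : acts_by_automorphisms Phi K.
Variables (g : G) (x : P).

Lemma differentiable_translation : differentiable_map (Phi g) x.
Proof. exact/differentiable_map_slice2/act_smooth. Qed.

(** Commutativity removes the adjoint action that would otherwise appear on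
    [xi]: translation by [g] maps the orbit curve k x to k (g x). *)
Lemma tmap_translation_generator xi :
  tmap (Phi g) x (generator Phi x xi) = generator Phi (Phi g x) xi.
Proof.
have Phi_x := differentiable_map_slice1 (lone G) x (act_smooth Phi).
rewrite /generator; symmetry.
rewrite -(tmap_comp (F := Phi^~ x) (act1 Phi x) Phi_x differentiable_translation).
rewrite (_ : Phi g \o Phi^~ x = Phi^~ (Phi g x)) //.
by apply/funext => k /=; rewrite -!actM G_abelian.
Qed.

Lemma inertia_translation : inertia K Phi (Phi g x) = inertia K Phi x.
Proof.
apply/funext => xi; apply: pairing_injl => eta.
rewrite [LHS]inertiaP [RHS]inertiaP.
have [_ _ /(_ (generator Phi x xi) (generator Phi x eta)) <-] := Phi_aut g x.
by do 2! rewrite tmap_translation_generator.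
Qed.

Lemma tmap_translation_cplx_generator nu :
  tmap (Phi g) x (cplx K x (generator Phi x (inertia_inv K Phi x nu))) =
  cplx K (Phi g x)
    (generator Phi (Phi g x) (inertia_inv K Phi (Phi g x) nu)).
Proof.
have [_ <- _] := Phi_aut g x.
by rewrite tmap_translation_generator /inertia_inv inertia_translation.
Qed.

End Translation.

(** * The quotient *)

Section Reduction.
Context {R : realType} {d n q : nat} {G : lie_group R d}.
Context {P : manifold R n} {Q : manifold R q}.
Variables (K : almost_kahler P) (Phi : action G P) (pi : P -> Q).
Variables (J : P -> dual_algebra G) (j : Q -> dual_algebra G).
Hypothesis G_abelian : abelian_group G.
Hypothesis Phi_aut : acts_by_automorphisms Phi K.
Hypothesis pi_orbit : orbit_projection Phi pi.
Hypothesis J_momentum : momentum_map Phi (omega K) J.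
Hypothesis J_submersion : linear_submersion J.
Hypothesis j_factor : forall x, J x = j (pi x).
Hypothesis j_smooth : smooth_fun j.
Implicit Types (x : P) (nu : dual_algebra G).

Lemma projection_invariant g x : pi (Phi g x) = pi x.
Proof. by have [_ _ _ fib] := pi_orbit; symmetry; apply/fib; exists g. Qed.

Lemma momentum_invariant g x : J (Phi g x) = J x.
Proof. by rewrite !j_factor projection_invariant. Qed.

Lemma projection_differentiable x : differentiable_map pi x.
Proof. by have [pis _ _ _] := pi_orbit; exact: smooth_map_differentiable. Qed.

Lemma dfun_projection (W : normedModType R) (f : P -> W) (h : Q -> W) x :
  smooth_fun h -> (forall z, f z = h (pi z)) ->
  forall v : tangent x, dfun f x v = dfun h (pi x) (tmap pi x v).
Proof.
move=> hs fE v; rewrite (_ : f = h \o pi); last exact/funext.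
apply: dfun_comp => //; first exact: projection_differentiable.
exact: smooth_fun_differentiable.
Qed.

(** The value of L(D, pi x) at [nu], computed at [x]; see [lift_mapE]. *)
Definition locked_lift x nu : tangent (pi x) :=
  tmap pi x (cplx K x (generator Phi x (inertia_inv K Phi x nu))).

(** Two points of a fiber differ by a translation, which intertwines all the
    ingredients and is annihilated by the projection. *)
Lemma locked_lift_fiber x x' nu :
  pi x = pi x' -> locked_lift x nu = locked_lift x' nu :> 'rV[R]_q.
Proof.
have [_ _ _ fib] := pi_orbit; move=> /fib[g ->].
rewrite /locked_lift -(tmap_translation_cplx_generator G_abelian Phi_aut).
have Phid := differentiable_translation Phi g x.
apply: etrans (tmap_comp erefl Phid (projection_differentiable _) _).
rewrite (_ : pi \o Phi g = pi) //.
by apply/funext => z /=; rewrite projection_invariant.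
Qed.

(** Membership of [locked_lift x nu] in D and its momentum derivative make it a
    candidate. Any other candidate is the projection of some xi_P + I eta_P, at a
    possibly different point of the fiber, and its momentum derivative [nu]
    forces eta = II^-1 nu. *)
Lemma lift_mapE x nu : lift_map K Phi pi J (pi x) nu = locked_lift x nu.
Proof.
rewrite /lift_map; set D := [set v | _].
have Dx : D (locked_lift x nu).
  split.
    exists x; split=> //.
    exists (cplx K x (generator Phi x (inertia_inv K Phi x nu))) => //.
    exact: cplx_generator_perp.
  exists x; split=> //.
  exists (cplx K x (generator Phi x (inertia_inv K Phi x nu))) => //.
  rewrite (dmomentum_cplx_generator J_momentum).
  exact: (inertia_invK J_momentum J_submersion).
(* D does not require the point [x1] witnessing that the vector lies in the
   connection to be the point [x2] witnessing its momentum derivative. *)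
have [[x1 [x1y [w1 w1A w1v]]] [x2 [x2y [w2 w2v w2J]]]] :=
  xgetPex 0 (ex_intro D _ Dx).
have w1J : dfun J x1 w1 = nu.
  have dJE z (w : tangent z) v :
      pi z = pi x -> tmap pi z w = v -> dfun J z w = dfun j (pi x) v.
    by move=> <- <-; exact: dfun_projection.
  by rewrite -w2J; apply: (etrans (dJE x1 w1 _ x1y w1v)); symmetry; exact: dJE.
rewrite -w1v -(locked_lift_fiber nu x1y).
rewrite (rec_hor_perp J_momentum J_submersion momentum_invariant w1A) w1J.
rewrite linearD /= tmap_generator ?add0r //.
  exact: projection_differentiable.
by move=> g; exact: projection_invariant.
Qed.

(** Invariance of [H] makes X_H - zeta_P a reconstruction vector, with zeta the
    phase at [x]; so X_H and zeta_P have the same metric products with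
    generators. By [locked_lift_fiber] the right-hand side depends only on
    [pi x], whence the phase does not depend on the point of the fiber. *)
Lemma pairing_reconstruction
    (alpha : forall x : P, {linear tangent x -> lie_algebra G}) (H : P -> R)
    (h : Q -> R) (XH : forall x : P, tangent x) x nu :
  smooth_fun (W := R) H -> smooth_fun (W := R) h ->
  (forall z, H z = h (pi z)) ->
  hamiltonian_vector_field (omega K) H XH ->
  induced_connection K Phi J alpha ->
  pairing nu (alpha x (XH x)) = dfun h (pi x) (locked_lift x nu).
Proof.
move=> Hs hs hH XHH alphaP; have [alpha_gen alpha_hor] := alphaP x.
have H_inv g : H (Phi g x) = H x by rewrite !hH projection_invariant.
pose zeta := alpha x (XH x); pose eta := inertia_inv K Phi x nu.
have XJ : dfun J x (XH x) = 0.
  apply: pairing_injl => xi; rewrite (pairing_dmomentum J_momentum) omegaC XHH.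
  rewrite dfun_generator ?oppr0 ?/pairing ?mulmx0 ?mxE //.
  exact: smooth_fun_differentiable.
have XA : rec_hor K Phi J (x:=x) (XH x - generator Phi x zeta).
  apply/alpha_hor; last by rewrite linearB /= alpha_gen subrr.
  rewrite /ker_TJ /= linearB /= XJ.
  by rewrite (dmomentum_generator J_momentum momentum_invariant) subr0.
have [/(_ eta) + _] := XA; rewrite linearBl /= => /subr0_eq XE.
rewrite -[in LHS](inertia_invK J_momentum J_submersion x nu) inertiaP.
rewrite metricC -/zeta -XE.
by rewrite -(dfun_projection hs hH) -XHH omega_cplxr.
Qed.

End Reduction.

Theorem theorem4p12 (R : realType) (n d q : nat)
  (P : manifold R n) (G : lie_group R d) (Q : manifold R q)
  (K : almost_kahler P) (Phi : action G P)
  (pi : P -> Q) (J : P -> dual_algebra G) (j : Q -> dual_algebra G)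
  (H : P -> R) (h : Q -> R) (XH : forall x : P, tangent x)
  (alpha : forall x : P, {linear tangent x -> lie_algebra G})
  (G_abelian : abelian_group G)
  (Phi_free : free_action Phi)
  (Phi_proper : proper_action Phi)
  (Phi_aut : acts_by_automorphisms Phi K)
  (pi_orbit : orbit_projection Phi pi)
  (J_momentum : momentum_map Phi (omega K) J)
  (J_equivariant : equivariant Phi J)
  (J_submersion : linear_submersion J)
  (j_factor : forall x, J x = j (pi x))
  (j_submersion : linear_submersion j)
  (j_connected : forall y : Q, connected [set z | j z = j y])
  (H_smooth : smooth_fun (W := R) H)
  (H_invariant : forall g x, H (Phi g x) = H x)
  (h_smooth : smooth_fun (W := R) h)
  (h_reduced : forall x, H x = h (pi x))
  (XH_hamiltonian : hamiltonian_vector_field (omega K) H XH)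
  (alpha_induced : induced_connection K Phi J alpha) :
  forall (y : Q) (x : P), pi x = y -> forall nu : dual_algebra G,
    pairing nu (dyn_phase pi alpha XH y)
      = pairing nu (ext_cov_deriv K Phi pi J h y) /\
    pairing nu (ext_cov_deriv K Phi pi J h y)
      = dfun h y (tmap pi x (cplx K x (generator Phi x (inertia_inv K Phi x nu)))).
Proof.
move=> _ x <- nu.
have liftE := lift_mapE G_abelian Phi_aut pi_orbit J_momentum J_submersion
  j_factor j_submersion.1.
have phaseE x' : pi x' = pi x -> forall nu',
    pairing nu' (alpha x' (XH x')) =
    dfun h (pi x) (lift_map K Phi pi J (pi x) nu').
  move=> <- nu'.
  rewrite liftE; exact: (pairing_reconstruction pi_orbit J_momentum J_submersion j_factor _ _
    H_smooth h_smooth h_reduced XH_hamiltonian alpha_induced).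
have derivE : forall nu', pairing nu' (ext_cov_deriv K Phi pi J h (pi x)) =
    dfun h (pi x) (lift_map K Phi pi J (pi x) nu').
  rewrite /ext_cov_deriv; case: xgetP => // /(_ (alpha x (XH x))) [].
  exact: phaseE.
have [x' x'y ->] : exists2 x', pi x' = pi x &
    dyn_phase pi alpha XH (pi x) = alpha x' (XH x').
  by rewrite /dyn_phase; case: xgetP => // /(_ (alpha x (XH x))) []; exists x.
split; first by rewrite derivE phaseE.
by rewrite derivE liftE.
Qed.
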